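(* Let $N_t,N_r,L\ge1$, $N_0>0$, let $\boldsymbol{\Sigma}_1,\dots,\boldsymbol{\Sigma}_L$ be $N_t\times N_t$ Hermitian positive definite matrices, let $l\in\{1,\dots,L\}$, let $\mathbf{F}_l\in\mathbb{C}^{N_t\times N_t}$, and let $\mathbf{H}_l$ be a random $N_r\times N_t$ complex matrix with $\mathbf{R}_{g,l}=E[\mathbf{H}_l^H\mathbf{H}_l]$ finite and positive definite. With $R_l$, $\mathbf{A}_l,\mathbf{B}_l,\mathbf{C}_l$ as in the context, and $\mathbf{D}_l=\mathbf{B}_l-\mathbf{A}_l^H\mathbf{C}_l^{-1}\mathbf{A}_l$, $$R_l\le R_{{\rm upp},l}=\log_2\det(\boldsymbol{\Sigma}_l)-\log_2\det(\mathbf{C}_l)-\Big[\log_2\det\Big(\mathbf{R}_{g,l}\Big(\mathbf{D}_l+\sum_{t=l+1}^L\boldsymbol{\Sigma}_t\Big)+N_0\mathbf{I}_{N_t}\Big)-\log_2\det\Big(\mathbf{R}_{g,l}\Big(\mathbf{B}_l+\sum_{t=l+1}^L\boldsymbol{\Sigma}_t\Big)+N_0\mathbf{I}_{N_t}\Big)\Big].$$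
   Context: Define $\boldsymbol{\Sigma}_{S,l}=\sum_{t=1}^{l-1}\boldsymbol{\Sigma}_t$ (zero for $l=1$), $\mathbf{A}_l=\mathbf{F}_l\boldsymbol{\Sigma}_{S,l}+\boldsymbol{\Sigma}_l$, $\mathbf{B}_l=\boldsymbol{\Sigma}_{S,l}+\boldsymbol{\Sigma}_l$, $\mathbf{C}_l=\mathbf{F}_l\boldsymbol{\Sigma}_{S,l}\mathbf{F}_l^H+\boldsymbol{\Sigma}_l$, $\boldsymbol{\Sigma}_{Z,l}(\mathbf{H}_l)=\mathbf{H}_l\big(\sum_{t=l+1}^L\boldsymbol{\Sigma}_t\big)\mathbf{H}_l^H+N_0\mathbf{I}_{N_r}$, $\boldsymbol{\Sigma}_{\mathbf{u}_l|\mathbf{y}_l,\mathbf{H}_l}(\mathbf{H}_l)=\mathbf{C}_l-\mathbf{A}_l\mathbf{H}_l^H\big[\mathbf{H}_l\mathbf{B}_l\mathbf{H}_l^H+\boldsymbol{\Sigma}_{Z,l}(\mathbf{H}_l)\big]^{-1}\mathbf{H}_l\mathbf{A}_l^H$, and the linear assignment achievable rate $R_l=\log_2\det(\boldsymbol{\Sigma}_l)-E\big[\log_2\det\boldsymbol{\Sigma}_{\mathbf{u}_l|\mathbf{y}_l,\mathbf{H}_l}(\mathbf{H}_l)\big]$. *)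

(* Defs.v *)
From HB Require Import structures.
From mathcomp Require Import all_boot all_order all_algebra.
From mathcomp Require Import all_classical all_reals all_analysis.
From mathcomp Require Import complex.
Set Implicit Arguments. Unset Strict Implicit. Unset Printing Implicit Defensive.
Import Order.TTheory GRing.Theory Num.Theory.
Local Open Scope ring_scope.

Definition hermT (R : rcfType) (m n : nat) (A : 'M[R[i]]_(m, n)) : 'M[R[i]]_(n, m) :=
  (map_mx (@Num.conj _) A)^T.

Definition herm_pd (R : rcfType) (n : nat) (A : 'M[R[i]]_n) : Prop :=
  hermT A = A /\
  forall v : 'cV[R[i]]_n, v != 0 -> 0 < (hermT v *m A *m v) ord0 ord0.

(* log2 det M; applied only to matrices whose determinant is a positive real,
   so the real part is the determinant itself *)
Definition log2det (R : realType) (n : nat) (M : 'M[R[i]]_n) : R :=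
  ln (complex.Re (\det M)) / ln 2.

Definition cexpect (R : realType) (d : measure_display) (Omega : measurableType d)
  (P : probability Omega R) (f : Omega -> R[i]) : R[i] :=
  Complex (Rintegral P setT (fun w => complex.Re (f w)))
  (Rintegral P setT (fun w => complex.Im (f w))).

Definition mexpect (R : realType) (d : measure_display) (Omega : measurableType d)
  (P : probability Omega R) (m n : nat) (X : Omega -> 'M[R[i]]_(m, n)) : 'M[R[i]]_(m, n) :=
  \matrix_(i, j) cexpect P (fun w => X w i j).

Definition SigmaS (R : rcfType) (Nt : nat) (Sigma : nat -> 'M[R[i]]_Nt) (l : nat) :=
  \sum_(1 <= t < l) Sigma t.
Definition SigmaRest (R : rcfType) (Nt L : nat) (Sigma : nat -> 'M[R[i]]_Nt) (l : nat) :=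
  \sum_(l.+1 <= t < L.+1) Sigma t.

Definition Amat (R : rcfType) Nt (Sigma : nat -> 'M[R[i]]_Nt) (F : 'M[R[i]]_Nt) l :=
  F *m SigmaS Sigma l + Sigma l.
Definition Bmat (R : rcfType) Nt (Sigma : nat -> 'M[R[i]]_Nt) l :=
  SigmaS Sigma l + Sigma l.
Definition Cmat (R : rcfType) Nt (Sigma : nat -> 'M[R[i]]_Nt) (F : 'M[R[i]]_Nt) l :=
  F *m SigmaS Sigma l *m hermT F + Sigma l.
Definition Dmat (R : rcfType) Nt (Sigma : nat -> 'M[R[i]]_Nt) (F : 'M[R[i]]_Nt) l :=
  Bmat Sigma l - hermT (Amat Sigma F l) *m invmx (Cmat Sigma F l) *m Amat Sigma F l.

Definition SigmaZ (R : rcfType) Nt Nr L (Sigma : nat -> 'M[R[i]]_Nt) (N0 : R) l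
  (H : 'M[R[i]]_(Nr, Nt)) : 'M[R[i]]_Nr :=
  H *m SigmaRest L Sigma l *m hermT H + ((N0%:C)%C)%:M.

Definition SigmaUY (R : rcfType) Nt Nr L (Sigma : nat -> 'M[R[i]]_Nt) (F : 'M[R[i]]_Nt)
  (N0 : R) l (H : 'M[R[i]]_(Nr, Nt)) : 'M[R[i]]_Nt :=
  Cmat Sigma F l - Amat Sigma F l *m hermT H
     *m invmx (H *m Bmat Sigma l *m hermT H + SigmaZ L Sigma N0 l H)
     *m H *m hermT (Amat Sigma F l).

Definition rate (R : realType) (d : measure_display) (Omega : measurableType d)
  (P : probability Omega R) Nt Nr L (Sigma : nat -> 'M[R[i]]_Nt) (F : 'M[R[i]]_Nt)
  (N0 : R) l (H : Omega -> 'M[R[i]]_(Nr, Nt)) : \bar R :=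
  ((log2det (Sigma l))%:E -
   \int[P]_(w in setT) (log2det (SigmaUY L Sigma F N0 l (H w)))%:E)%E.

Definition rate_upp (R : realType) Nt L (Sigma : nat -> 'M[R[i]]_Nt) (F : 'M[R[i]]_Nt)
  (N0 : R) l (Rg : 'M[R[i]]_Nt) : R :=
  log2det (Sigma l) - log2det (Cmat Sigma F l)
  - (log2det (Rg *m (Dmat Sigma F l + SigmaRest L Sigma l) + ((N0%:C)%C)%:M)
     - log2det (Rg *m (Bmat Sigma l + SigmaRest L Sigma l) + ((N0%:C)%C)%:M)).

(* Main.v *)
Require Import Defs.
From HB Require Import structures.
From mathcomp Require Import all_boot all_order all_algebra.
From mathcomp Require Import all_classical all_reals all_analysis.
From mathcomp Require Import complex ring lra.
Import Order.TTheory GRing.Theory Num.Theory.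
Local Open Scope ring_scope.

(** Put [G = H^H H], [W = B + sum_(t > l) Sigma_t] and
    [V = D + sum_(t > l) Sigma_t = W - A^H C^-1 A], which is positive
    semidefinite.  By Woodbury, the inverse of the error covariance is
    [J(G) = C^-1 + C^-1 A Phi(G) A^H C^-1] with
    [Phi(G) = H^H (H V H^H + N0)^-1 H].  The gain [Phi] is operator concave in
    [G], being the minimum over [T] of the expressions
    [T^H V T + N0^-1 (1 - V T)^H G (1 - V T)], each affine in [G]; and
    [- ln det] is convex and decreasing.  Hence [ln det] of the error covariance
    is bounded below by a function affine in [G] that is tangent at [E G], and
    taking expectations gives Jensen's inequality.  The value at [E G] is turned
    into the stated bound by [det (1 + X Y) = det (1 + Y X)]. *)

(** * Positive matrices over [R[i]]: closure, congruence, spectrum of a pencil *)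

Section HermitianMatrices.
Local Set Implicit Arguments.
Local Unset Strict Implicit.
Variable R : rcfType.
Implicit Types m n p : nat.

Lemma hermTK m n (A : 'M[R[i]]_(m, n)) : hermT (hermT A) = A.
Proof. by apply/matrixP => i j; rewrite !mxE conjCK. Qed.

Lemma hermTM m n p (A : 'M[R[i]]_(m, n)) (B : 'M[R[i]]_(n, p)) :
  hermT (A *m B) = hermT B *m hermT A.
Proof. by rewrite /hermT map_mxM trmx_mul. Qed.

Lemma hermTD m n (A B : 'M[R[i]]_(m, n)) : hermT (A + B) = hermT A + hermT B.
Proof. by rewrite /hermT map_mxD linearD. Qed.

Lemma hermTB m n (A B : 'M[R[i]]_(m, n)) : hermT (A - B) = hermT A - hermT B.
Proof. by rewrite /hermT map_mxB linearB. Qed.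

Lemma hermT0 m n : hermT (0 : 'M[R[i]]_(m, n)) = 0.
Proof. by rewrite /hermT map_mx0 trmx0. Qed.

Lemma hermT1 n : hermT (1%:M : 'M[R[i]]_n) = 1%:M.
Proof. by rewrite /hermT map_mx1 trmx1. Qed.

Lemma hermTV n (A : 'M[R[i]]_n) : hermT (invmx A) = invmx (hermT A).
Proof. by rewrite /hermT map_invmx trmx_inv. Qed.

Lemma conj_real_complex (a : R) : Num.conj (a%:C)%C = (a%:C)%C.
Proof. by apply/CrealP; apply/complex_realP; exists a. Qed.

Lemma hermTZ m n (a : R) (A : 'M[R[i]]_(m, n)) :
  hermT ((a%:C)%C *: A) = (a%:C)%C *: hermT A.
Proof. by apply/matrixP => i j; rewrite !mxE rmorphM /= conj_real_complex. Qed.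

Definition herm_psd n (A : 'M[R[i]]_n) : Prop :=
  hermT A = A /\
  forall v : 'cV[R[i]]_n, 0 <= (hermT v *m A *m v) ord0 ord0.

Lemma herm_pd_psd n (A : 'M[R[i]]_n) : herm_pd A -> herm_psd A.
Proof.
move=> [hA pA]; split=> // v; have [->|/pA/ltW //] := eqVneq v 0.
by rewrite mulmx0 mxE.
Qed.

Lemma herm_psd0 n : herm_psd (0 : 'M[R[i]]_n).
Proof. by split=> [|v]; rewrite ?hermT0 // mulmx0 mul0mx mxE. Qed.

Lemma herm_psdD n (A B : 'M[R[i]]_n) :
  herm_psd A -> herm_psd B -> herm_psd (A + B).
Proof.
move=> [hA pA] [hB pB]; split=> [|v]; first by rewrite hermTD hA hB.
by rewrite mulmxDr mulmxDl mxE addr_ge0.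
Qed.

Lemma herm_pdD n (A B : 'M[R[i]]_n) :
  herm_pd A -> herm_psd B -> herm_pd (A + B).
Proof.
move=> [hA pA] [hB pB]; split=> [|v v0]; first by rewrite hermTD hA hB.
by rewrite mulmxDr mulmxDl mxE ltr_wpDr ?pA.
Qed.

Lemma herm_psd_sum n I (s : seq I) (A : I -> 'M[R[i]]_n) (P : pred I) :
  (forall i, P i -> herm_psd (A i)) -> herm_psd (\sum_(i <- s | P i) A i).
Proof. by move=> psdA; apply: big_ind => //; [exact: herm_psd0|exact: herm_psdD]. Qed.

Lemma herm_psd_congr m n (A : 'M[R[i]]_n) (T : 'M[R[i]]_(n, m)) :
  herm_psd A -> herm_psd (hermT T *m A *m T).
Proof.
move=> [hA pA]; split=> [|v]; first by rewrite !hermTM hermTK hA mulmxA.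
by have := pA (T *m v); rewrite hermTM !mulmxA.
Qed.

Lemma herm_psdZ n (a : R) (A : 'M[R[i]]_n) :
  0 <= a -> herm_psd A -> herm_psd ((a%:C)%C *: A).
Proof.
move=> a0 [hA pA]; split=> [|v]; first by rewrite hermTZ hA.
by rewrite -scalemxAr -scalemxAl mxE mulr_ge0 // ler0c.
Qed.

Lemma herm_pdZ n (a : R) (A : 'M[R[i]]_n) :
  0 < a -> herm_pd A -> herm_pd ((a%:C)%C *: A).
Proof.
move=> a0 [hA pA]; split=> [|v v0]; first by rewrite hermTZ hA.
by rewrite -scalemxAr -scalemxAl mxE mulr_gt0 ?pA // ltcR.
Qed.

Lemma herm_pd1 n : herm_pd (1%:M : 'M[R[i]]_n).
Proof.
split=> [|v v0]; first exact: hermT1.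
rewrite mulmx1 mxE (eq_bigr (fun i => `|v i 0| ^+ 2)); last first.
  by move=> i _; rewrite !mxE mulrC normCK.
rewrite lt0r sumr_ge0 ?andbT; last by move=> i _; rewrite exprn_ge0.
apply: contraNneq v0 => /psumr_eq0P E; apply/eqP/matrixP => i j.
rewrite ord1 [RHS]mxE; apply/normr0_eq0/eqP; rewrite -sqrf_eq0.
by apply/eqP/E => // k _; rewrite exprn_ge0.
Qed.

Lemma herm_pd_scalar n (a : R) : 0 < a -> herm_pd ((a%:C)%C%:M : 'M[R[i]]_n).
Proof. by move=> a0; rewrite -scalemx1; apply/herm_pdZ/herm_pd1. Qed.

Lemma herm_pd_unitmx n (A : 'M[R[i]]_n) : herm_pd A -> A \in unitmx.
Proof.
move=> [hA pA]; rewrite unitmxE unitfE; apply/det0P => -[v v0 vA].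
have : hermT v != 0 by apply: contraNneq v0 => h; rewrite -[v]hermTK h hermT0.
by move/pA; rewrite hermTK vA mul0mx mxE ltxx.
Qed.

Lemma herm_pdV n (A : 'M[R[i]]_n) : herm_pd A -> herm_pd (invmx A).
Proof.
move=> pdA; have uA := herm_pd_unitmx pdA; case: pdA => hA pA.
split=> [|v v0]; first by rewrite hermTV hA.
have /pA : invmx A *m v != 0.
  by apply: contraNneq v0 => h; rewrite -[v](mulKVmx uA) h mulmx0.
by rewrite hermTM hermTV hA !mulmxA mulmxKV.
Qed.

(* An eigenvalue [a] of [invmx P *m Q] satisfies [u Q = a u P] for some nonzero
   row [u], hence is the quotient of two values of quadratic forms. *)
Lemma pencil_spectrum n (P Q : 'M[R[i]]_n) : (0 < n)%N ->
  herm_pd P -> herm_psd Q ->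
  exists s : seq R, [/\ size s = n, {in s, forall x, 0 <= x},
    \det (invmx P *m Q) = ((\prod_(x <- s) x)%:C)%C &
    \tr (invmx P *m Q) = ((\sum_(x <- s) x)%:C)%C].
Proof.
move=> n0 pdP [hQ pQ]; have uP := herm_pd_unitmx pdP; case: pdP => hP pP.
set M := invmx P *m Q.
have [s] := closed_field_poly_normal (char_poly M).
rewrite (monicP (char_poly_monic M)) scale1r => Es.
have szs : size s = n.
  by apply: succn_inj; rewrite -(size_char_poly M) Es size_prod_XsubC.
have s_ge0 a : a \in s -> 0 <= a.
  rewrite -root_prod_XsubC -Es -eigenvalue_root_char => /eigenvalueP[v vM v0].
  pose c := hermT (v *m invmx P).
  have c0 : c != 0.
    apply: contraNneq v0 => h; rewrite -[v](mulmxKV uP) -[_ *m invmx P]hermTK.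
    by rewrite -/c h hermT0 mul0mx.
  have E : hermT c *m Q = a *: (hermT c *m P).
    by rewrite hermTK mulmxKV // -mulmxA vM.
  have := pQ c; rewrite E -scalemxAl mxE pmulr_lge0 //; exact: pP.
have Ere : s = map (real_complex R) (map (@complex.Re R) s).
  rewrite -map_comp -[LHS]map_id; apply/eq_in_map => a /s_ge0 a0 /=.
  by rewrite RRe_real // ger0_real.
exists (map (@complex.Re R) s); split; first by rewrite size_map.
- by move=> _ /mapP[a /s_ge0 + ->]; rewrite lecE => /andP[].
- have := char_poly_det M; rewrite Es coef0_prod_XsubC szs => /(mulrI _) <-.
    by rewrite {1}Ere !big_map rmorph_prod.
  by rewrite unitrX // unitrN1.
- have := char_poly_trace M n0; rewrite Es -{1}szs coefPn_prod_XsubC ?szs -?lt0n //.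
  by move=> /oppr_inj <-; rewrite {1}Ere !big_map rmorph_sum.
Qed.

(** Although [invmx P *m Q] need not be Hermitian, its eigenvalues are nonnegative reals and the
    trace is their sum. *)
Lemma trace_pd_psd_ge0 n (P Q : 'M[R[i]]_n) : (0 < n)%N ->
  herm_pd P -> herm_psd Q -> 0 <= complex.Re (\tr (invmx P *m Q)).
Proof.
move=> n0 pdP psdQ; have [s [_ s0 _ ->]] := pencil_spectrum n0 pdP psdQ.
by rewrite /= big_seq sumr_ge0.
Qed.

Lemma det_pd_gt0 n (P : 'M[R[i]]_n) : (0 < n)%N -> herm_pd P -> 0 < \det P.
Proof.
move=> n0 pdP; have uP := herm_pd_unitmx pdP.
have [s [_ s0 + _]] := pencil_spectrum n0 (herm_pd1 n) (herm_pd_psd pdP).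
rewrite invmx1 mul1mx => E.
rewrite lt0r E ler0c big_seq prodr_ge0 // andbT -big_seq -E.
by move: uP; rewrite unitmxE unitfE.
Qed.

End HermitianMatrices.

(** * Algebraic identities for the gain, over any field *)

Section ResolventIdentities.
Local Set Implicit Arguments.
Local Unset Strict Implicit.
Variables (K : fieldType) (n m : nat).
Implicit Types (A Ac C V W G Phi T Tc : 'M[K]_n) (H : 'M[K]_(m, n)) (Hc : 'M[K]_(n, m)).

(* [Hc], [Ac] and [Tc] stand for the conjugate transposes of [H], [A], [T]. *)
Definition gain (c : K) V H Hc := Hc *m invmx (H *m V *m Hc + c%:M) *m H.

Lemma mul_gainD c A Ac V W H Hc : A *m gain c (V + W) H Hc *m Ac =
  A *m Hc *m invmx (H *m V *m Hc + (H *m W *m Hc + c%:M)) *m H *m Ac.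
Proof. by rewrite /gain mulmxDr mulmxDl !mulmxA addrA. Qed.

(** Push-through: [(Hc H V + c) Hc = Hc (H V Hc + c)]. The resulting equation involves [H] only
    through [G = Hc H], so it still makes sense at [E G]. *)
Lemma gain_eqn c V H Hc : H *m V *m Hc + c%:M \in unitmx ->
  (Hc *m H *m V + c%:M) *m gain c V H Hc = Hc *m H.
Proof.
rewrite /gain; move EP: (_ + _) => P uP.
have E : (Hc *m H *m V + c%:M) *m Hc = Hc *m P.
  by rewrite -EP mulmxDl mulmxDr !mulmxA mul_scalar_mx mul_mx_scalar.
by rewrite !mulmxA E mulmxK.
Qed.

(** The identity [X^-1 - Y^-1 = Y^-1 (Y - X) X^-1], sandwiched between [Hc] and [H]. *)
Lemma gain_resolvent c V W H Hc :
  H *m V *m Hc + c%:M \in unitmx -> H *m W *m Hc + c%:M \in unitmx ->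
  gain c W H Hc *m (W - V) *m gain c V H Hc = gain c V H Hc - gain c W H Hc.
Proof.
rewrite /gain; move EV: (H *m V *m Hc + _) => PV uV.
move EW: (H *m W *m Hc + _) => PW uW.
have E : H *m (W - V) *m Hc = PW - PV.
  by rewrite mulmxBr mulmxBl -EV -EW opprD addrACA subrr addr0.
transitivity (Hc *m invmx PW *m (PW - PV) *m invmx PV *m H).
  by rewrite -E !mulmxA.
rewrite mulmxBr mulmxBl mulmxBl mulmxKV //; congr (_ - _ *m H).
by rewrite -mulmxA mulmxV // mulmx1.
Qed.

(** After expansion, the only term quadratic in the gains contains [W - V = Ac C^-1 A]; the
    resolvent identity splits it into the two linear terms, and everything but [1] cancels. *)
Lemma woodbury_gain c A Ac C V W H Hc :
  C \in unitmx -> W = V + Ac *m invmx C *m A ->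
  H *m V *m Hc + c%:M \in unitmx -> H *m W *m Hc + c%:M \in unitmx ->
  (C - A *m gain c W H Hc *m Ac) *m
  (invmx C + invmx C *m A *m gain c V H Hc *m Ac *m invmx C) = 1%:M.
Proof.
move=> uC EW uV uW; have := gain_resolvent uV uW.
rewrite {2}EW addrC addKr; move: (gain c V H Hc) (gain c W H Hc) => X Y E.
have {}E : A *m Y *m Ac *m invmx C *m A *m X *m Ac *m invmx C =
    A *m X *m Ac *m invmx C - A *m Y *m Ac *m invmx C.
  by rewrite -!mulmxBl -mulmxBr -E !mulmxA.
rewrite mulmxBl !mulmxDr mulmxV // !mulmxA mulmxV // mul1mx E.
by rewrite subrKC addrK.
Qed.

(** Sylvester's identity: one block matrix is factored in two ways into block triangular ones. *)
Lemma det_1DmulC p q (A : 'M[K]_(p, q)) (B : 'M[K]_(q, p)) :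
  \det (1%:M + A *m B) = \det (1%:M + B *m A).
Proof.
have E1 : block_mx 1%:M (- A) B 1%:M =
    block_mx 1%:M 0 B 1%:M *m block_mx 1%:M (- A) 0 (1%:M + B *m A).
  rewrite mulmx_block !mul1mx !mul0mx !mulmx1 !addr0 mulmxN.
  by rewrite addrCA addNr addr0.
have E2 : block_mx 1%:M (- A) B 1%:M =
    block_mx (1%:M + A *m B) (- A) 0 1%:M *m block_mx 1%:M 0 B 1%:M.
  rewrite mulmx_block !mulmx1 !mul0mx !mul1mx !mulmx0 !add0r mulNmx.
  by rewrite addrK.
by have := E1; rewrite E2 => /(congr1 determinant);
  rewrite !det_mulmx !det_ublock !det_lblock !det1 !mulr1 !mul1r.
Qed.

(* [Phi] minimises the first two terms over [T] and [Tc], and these are affine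
   in [G]: the identity exhibits [Phi] as an operator-concave function of [G]. *)
Lemma gain_variational b c V G Phi T Tc : b * c = 1 ->
  (G *m V + c%:M) *m Phi = G -> Phi *m (V *m G + c%:M) = G ->
  Tc *m V *m T + b *: ((1%:M - Tc *m V) *m G *m (1%:M - V *m T)) - Phi
  = (Tc - Phi) *m (V + b *: (V *m G *m V)) *m (T - Phi).
Proof.
move=> bc E1 E2; set M := V + _.
(* Since [b c = 1], [M = b V (G V + c) = b (V G + c) V], so the two equations for [Phi] evaluate
   [M Phi] and [Phi M]. *)
have MPhi : M *m Phi = b *: (V *m G).
  rewrite -[in RHS]E1 mulmxA mulmxDr mulmxA mul_mx_scalar mulmxDl scalerDr.
  by rewrite /M mulmxDl addrC -!scalemxAl scalerA bc scale1r.
have PhiM : Phi *m M = b *: (G *m V).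
  rewrite -[in RHS]E2 -mulmxA mulmxDl mul_scalar_mx mulmxDr scalerDr.
  by rewrite /M mulmxDr addrC -!scalemxAr scalerA bc scale1r.
have PhiVG : b *: (Phi *m V *m G) = b *: G - Phi.
  apply/eqP; rewrite eq_sym subr_eq -{1}E2 mulmxDr mul_mx_scalar mulmxA.
  by rewrite scalerDr scalerA bc scale1r.
have -> : (Tc - Phi) *m M *m (T - Phi) = Tc *m V *m T
    + b *: (Tc *m V *m G *m V *m T) - b *: (Tc *m V *m G)
    - b *: (G *m V *m T) + (b *: G - Phi).
  rewrite mulmxBr -[X in _ - X]mulmxA MPhi !mulmxBl PhiM.
  rewrite -PhiVG -scalemxAr /M mulmxDr mulmxDl !mulmxA.
  rewrite -!scalemxAl -!scalemxAr -!scalemxAl !mulmxA.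
  move: (Tc *m V *m T) (Tc *m V *m G) (G *m V *m T) (Phi *m V *m G)
    (Tc *m V *m G *m V *m T) => X1 X2 X3 X4 X5.
  by apply/matrixP => i j; rewrite !mxE; ring.
rewrite !(mulmxBr, mulmxBl) !mulmx1 !mul1mx !mulmxA.
move: (Tc *m V *m T) (Tc *m V *m G) (G *m V *m T)
    (Tc *m V *m G *m V *m T) => X1 X2 X3 X5.
by apply/matrixP => i j; rewrite !mxE; ring.
Qed.

(** Absorbing [C] leaves [det (1 + C^-1 A Phi Ac)]; Sylvester's identity brings [Phi] to the left,
    where [G V + c] turns it into [G]. *)
Lemma det_information c A Ac C V W G Phi : C \in unitmx ->
  W = V + Ac *m invmx C *m A -> (G *m V + c%:M) *m Phi = G ->
  \det (invmx C + invmx C *m A *m Phi *m Ac *m invmx C) * \det C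
    * \det (G *m V + c%:M) = \det (G *m W + c%:M).
Proof.
move=> uC -> E; rewrite -det_mulmx mulmxDl mulVmx // mulmxKV //.
rewrite -!mulmxA mulmxA det_1DmulC mulrC -det_mulmx mulmxDr mulmx1.
by congr (\det _); rewrite !mulmxA E mulmxDr !mulmxA addrAC.
Qed.

(** Cyclicity of the trace moves [G] to the end, exposing the coefficient matrix of the linear
    part. *)
Lemma trace_affine b (Pi Ci Bh X Y Z B G : 'M[K]_n) :
  \tr (Pi *m (Ci + Bh *m (X + b *: (Y *m G *m Z)) *m B))
  = \tr (Pi *m (Ci + Bh *m X *m B))
    + \tr ((b *: (Z *m B *m Pi *m Bh *m Y)) *m G).
Proof.
rewrite [Bh *m (_ + _)]mulmxDr mulmxDl addrA mulmxDr mxtraceD; congr (_ + _).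
rewrite -scalemxAr -!scalemxAl -scalemxAr !mxtraceZ; congr (_ * _).
transitivity (\tr ((Pi *m Bh *m Y *m G) *m (Z *m B))); first by rewrite !mulmxA.
by rewrite mxtrace_mulC !mulmxA.
Qed.

(* Completing the square in the Schur complement of [C]. *)
Lemma schur_complementE (S Sl F Fc T Tc C : 'M[K]_n) :
  C = F *m S *m Fc + Sl -> C *m T = F *m S + Sl -> Tc *m C = S *m Fc + Sl ->
  S + Sl - (S *m Fc + Sl) *m T =
  (1%:M - Tc *m F) *m S *m (1%:M - Fc *m T) + (1%:M - Tc) *m Sl *m (1%:M - T).
Proof.
move=> EC CT TC.
have E1 : (S *m Fc + Sl) *m T = Tc *m (F *m S + Sl) by rewrite -TC -CT mulmxA.
have E2 : Tc *m C *m T = (S *m Fc + Sl) *m T by rewrite TC.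
move: E1 E2; rewrite EC !(mulmxDr, mulmxDl, mulmxBr, mulmxBl) !mulmx1 !mul1mx.
rewrite !(mulmxN, mulNmx) !mulmxA.
move: (S *m Fc *m T) (Tc *m F *m S) (Sl *m T) (Tc *m Sl)
  (Tc *m F *m S *m Fc *m T) (Tc *m Sl *m T) => X1 X2 X3 X4 X5 X6 E1 E2.
apply/eqP; rewrite -subr_eq0; apply/eqP.
(* The two sides differ by [Tc (F S + Sl) - Tc C T], and both of these terms equal
   [(S Fc + Sl) T]. *)
transitivity ((X2 + X4) - (X5 + X6)); last by rewrite E2 E1 subrr.
by apply/matrixP => i j; rewrite !mxE; ring.
Qed.

End ResolventIdentities.

(** * Tangent bounds for [ln det] and for the gain *)

Section LogDetBounds.
Local Set Implicit Arguments.
Local Unset Strict Implicit.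
Variable R : realType.

Lemma ReD (x y : R[i]) : complex.Re (x + y) = complex.Re x + complex.Re y.
Proof. by case: x y => [a b] [c e]. Qed.

Lemma ReN (x : R[i]) : complex.Re (- x) = - complex.Re x.
Proof. by case: x. Qed.

Lemma Re_natr (n : nat) : complex.Re (n%:R : R[i]) = n%:R.
Proof. by elim: n => // n IHn; rewrite -!natr1 ReD IHn. Qed.

Lemma Re_mul_gt0 (x y : R[i]) : 0 < x ->
  complex.Re (x * y) = complex.Re x * complex.Re y.
Proof.
by case: x y => [a b] [c e]; rewrite ltcE /= => /andP[/eqP -> _]; rewrite mul0r subr0.
Qed.

Lemma Re_gt0 (x : R[i]) : 0 < x -> 0 < complex.Re x.
Proof. by rewrite ltcE => /andP[]. Qed.

Lemma ln_Re_mul (x y : R[i]) : 0 < x -> 0 < y ->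
  ln (complex.Re (x * y)) = ln (complex.Re x) + ln (complex.Re y).
Proof. by move=> x0 y0; rewrite Re_mul_gt0 // lnM // posrE Re_gt0. Qed.

Lemma ln_prod_le (s : seq R) : {in s, forall x, 0 < x} ->
  ln (\prod_(x <- s) x) <= \sum_(x <- s) x - (size s)%:R.
Proof.
elim: s => [|x s IHs] s0; first by rewrite !big_nil ln1 subr0.
have x0 : 0 < x by rewrite s0 ?mem_head.
have {}s0 : {in s, forall y, 0 < y} by move=> y ys; rewrite s0 // inE ys orbT.
rewrite !big_cons lnM ?posrE //; last by rewrite big_seq prodr_gt0.
have lnx : ln x <= x - 1.
  by rewrite -{1}(subrKC 1 x); apply: le_ln1Dx; rewrite ltrBDr addNr.
by rewrite /= -natr1; have := IHs s0; lra.
Qed.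

(** Concavity of [ln det]: the tangent at [P], obtained from [ln x <= x - 1] at the eigenvalues of
    [P^-1 Q]. *)
Lemma ln_det_le n (P Q : 'M[R[i]]_n) : (0 < n)%N -> herm_pd P -> herm_pd Q ->
  ln (complex.Re (\det Q)) <= ln (complex.Re (\det P))
    + complex.Re (\tr (invmx P *m Q)) - n%:R.
Proof.
move=> n0 pdP pdQ; have uP := herm_pd_unitmx pdP.
have dP := det_pd_gt0 n0 pdP; have dQ := det_pd_gt0 n0 pdQ.
have [s [szs s0 Ed ->]] := pencil_spectrum n0 pdP (herm_pd_psd pdQ).
have dPQ : 0 < \det (invmx P *m Q) by rewrite det_mulmx det_inv mulr_gt0 ?invr_gt0.
have -> : \det Q = \det P * \det (invmx P *m Q) by rewrite -det_mulmx mulKVmx.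
rewrite ln_Re_mul // -addrA lerD2l Ed -szs; apply: ln_prod_le => x xs.
rewrite lt0r s0 // andbT; apply: contraTneq dPQ => x0.
by rewrite Ed (big_rem x) //= x0 mul0r ltxx.
Qed.

(* The inverse of the error covariance when [X] is the gain. *)
Definition info n (C A X : 'M[R[i]]_n) :=
  invmx C + invmx C *m A *m X *m hermT A *m invmx C.

Lemma info_pd n (C A X : 'M[R[i]]_n) :
  herm_pd C -> herm_psd X -> herm_pd (info C A X).
Proof.
move=> pdC psdX; have pdCV := herm_pdV pdC; apply: (herm_pdD pdCV).
have := herm_psd_congr (hermT A *m invmx C) psdX.
by rewrite hermTM hermTK pdCV.1 !mulmxA.
Qed.

Lemma noise_pd n m (a : R) (V : 'M[R[i]]_n) (H : 'M[R[i]]_(m, n)) :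
  0 < a -> herm_psd V -> herm_pd (H *m V *m hermT H + (a%:C)%C%:M).
Proof.
move=> a0 psdV; rewrite addrC; apply: herm_pdD; first exact: herm_pd_scalar.
by have := herm_psd_congr (hermT H) psdV; rewrite hermTK.
Qed.

Lemma gain_psd n m (a : R) (V : 'M[R[i]]_n) (H : 'M[R[i]]_(m, n)) : 0 < a ->
  herm_psd V -> herm_psd (gain (a%:C)%C V H (hermT H)).
Proof.
by move=> a0 psdV; apply/herm_psd_congr/herm_pd_psd/herm_pdV/noise_pd.
Qed.

Lemma gram_psd n m (H : 'M[R[i]]_(m, n)) : herm_psd (hermT H *m H).
Proof.
by have := herm_psd_congr H (herm_pd_psd (herm_pd1 R m)); rewrite mulmx1.
Qed.

Lemma gain_eqn_herm n (a : R) (V G X : 'M[R[i]]_n) :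
  hermT V = V -> hermT G = G -> hermT X = X ->
  (G *m V + (a%:C)%C%:M) *m X = G -> X *m (V *m G + (a%:C)%C%:M) = G.
Proof.
move=> hV hG hX /(congr1 (@hermT _ _ _)); rewrite hermTM hX hG => E.
by rewrite -[RHS]E hermTD hermTM hG hV -scalemx1 hermTZ hermT1.
Qed.

(** The variational majorant of the gain. One letter [T] serves for the test matrix and its adjoint,
    the eventual choice [Phi] being Hermitian. *)
Definition gain_bound n (a : R) (V T G : 'M[R[i]]_n) :=
  T *m V *m T + (a^-1%:C)%C *: ((1%:M - T *m V) *m G *m (1%:M - V *m T)).

Lemma gain_boundB n (a : R) (V G X T : 'M[R[i]]_n) : 0 < a ->
  hermT V = V -> hermT G = G -> hermT X = X ->
  (G *m V + (a%:C)%C%:M) *m X = G ->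
  gain_bound a V T G - X =
  (T - X) *m (V + (a^-1%:C)%C *: (V *m G *m V)) *m (T - X).
Proof.
move=> a0 hV hG hX E.
have bc : (a^-1%:C)%C * (a%:C)%C = 1 :> R[i].
  by rewrite -rmorphM mulVf ?gt_eqF.
exact: (gain_variational T T bc E (gain_eqn_herm hV hG hX E)).
Qed.

(** The difference is a congruence of the semidefinite matrix [V + a^-1 V G V]. *)
Lemma gain_bound_psd n (a : R) (V G X T : 'M[R[i]]_n) : 0 < a ->
  herm_psd V -> herm_psd G -> hermT X = X -> hermT T = T ->
  (G *m V + (a%:C)%C%:M) *m X = G -> herm_psd (gain_bound a V T G - X).
Proof.
move=> a0 psdV psdG hX hT E.
rewrite (gain_boundB T a0 psdV.1 psdG.1 hX E).
have hTX : hermT (T - X) = T - X by rewrite hermTB hT hX.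
rewrite -{1}hTX; apply: herm_psd_congr; apply: (herm_psdD psdV).
apply: herm_psdZ; first by rewrite invr_ge0 ltW.
by have := herm_psd_congr V psdG; rewrite psdV.1.
Qed.

Lemma infoB n (C A X Y : 'M[R[i]]_n) : hermT C = C ->
  info C A X - info C A Y =
  hermT (hermT A *m invmx C) *m (X - Y) *m (hermT A *m invmx C).
Proof.
move=> hC; rewrite /info hermTM hermTK hermTV hC !mulmxA.
by rewrite mulmxBr !mulmxBl opprD addrACA subrr add0r.
Qed.

Lemma trace_info_le n (P C A X Y : 'M[R[i]]_n) : (0 < n)%N ->
  herm_pd P -> hermT C = C -> herm_psd (Y - X) ->
  complex.Re (\tr (invmx P *m info C A X))
    <= complex.Re (\tr (invmx P *m info C A Y)).
Proof.
move=> n0 pdP hC psdYX; rewrite -subr_ge0 -ReN -ReD -raddfB.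
rewrite -mulmxBr infoB //.
exact: (trace_pd_psd_ge0 n0 pdP (herm_psd_congr _ psdYX)).
Qed.

Lemma trace_info_bound n (a : R) (M C A V T : 'M[R[i]]_n) :
  exists t Q, forall G,
  \tr (M *m info C A (gain_bound a V T G)) = t + \tr (Q *m G).
Proof.
exists (\tr (M *m info C A (T *m V *m T))).
exists ((a^-1%:C)%C *: ((1%:M - V *m T) *m (hermT A *m invmx C) *m M
         *m (invmx C *m A) *m (1%:M - T *m V))) => G.
have E X : info C A X = invmx C + invmx C *m A *m X *m (hermT A *m invmx C).
  by rewrite /info !mulmxA.
by rewrite !E -trace_affine.
Qed.

Lemma ln_Re_inv (x y : R[i]) : 0 < y -> x * y = 1 ->
  ln (complex.Re x) = - ln (complex.Re y).
Proof.
move=> y0 xy; have x0 : 0 < x by rewrite -(pmulr_lgt0 _ y0) xy ltr01.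
by apply/eqP; rewrite -addr_eq0 -ln_Re_mul // xy ln1.
Qed.

(* Since [P := info C A Phi] is the information at [G = K], replacing the gain
   by its affine majorant tangent at [K] and [ln \det] by its tangent at [P]
   gives a minorant that is affine in [G = hermT H *m H] and exact at [K]. *)
Lemma ln_det_tangent n (a : R) (A C V W K : 'M[R[i]]_n) :
  (0 < n)%N -> 0 < a -> herm_pd C -> herm_psd V -> herm_pd K ->
  W = V + hermT A *m invmx C *m A ->
  exists k Q,
    (forall m (H : 'M[R[i]]_(m, n)), k + complex.Re (\tr (Q *m (hermT H *m H)))
      <= ln (complex.Re (\det
           (C - A *m gain (a%:C)%C W H (hermT H) *m hermT A)))) /\
    k + complex.Re (\tr (Q *m K)) = ln (complex.Re (\det C))
      + (ln (complex.Re (\det (K *m V + (a%:C)%C%:M)))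
         - ln (complex.Re (\det (K *m W + (a%:C)%C%:M)))).
Proof.
(* Here [q] is the dimension, [p] is [ln det P] and [t] the constant of the affine trace; [x] and
   [y] are the traces at the gain and at its majorant, and [j] is [ln det] of the information. *)
have arith1 (q p t x y j : R) : j <= p + x - q -> x <= y ->
    q - p - t + (t - y) <= - j by lra.
have arith2 (q p t c v : R) :
    q - p - t + (t - q) = c + (v - (p + c + v)) by lra.
move=> n0 a0 pdC psdV pdK EW.
have uC := herm_pd_unitmx pdC; have uK := herm_pd_unitmx pdK.
have psdW : herm_psd W.
  by rewrite EW; apply/herm_psdD/herm_psd_congr/herm_pd_psd/herm_pdV.
have pdKV : herm_pd ((a%:C)%C *: invmx K) by apply/herm_pdZ/herm_pdV.
(* [K U + a] need not be Hermitian, but for semidefinite [U] it is a product of two positive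
   definite matrices, whence the sign of its determinant. *)
have factor U : K *m U + (a%:C)%C%:M = K *m ((a%:C)%C *: invmx K + U).
  by rewrite mulmxDr -scalemxAr mulmxV // scalemx1 addrC.
have det_gt0 U : herm_psd U -> 0 < \det (K *m U + (a%:C)%C%:M).
  move=> psdU; rewrite factor det_mulmx; apply: mulr_gt0; apply: (det_pd_gt0 n0).
    exact: pdK.
  exact: (herm_pdD pdKV psdU).
have pdX : herm_pd ((a%:C)%C *: invmx K + V) by exact: (herm_pdD pdKV psdV).
(* The gain at [K], written without a factorisation [K = hermT H *m H]; it solves the same equation
   as in [gain_eqn]. *)
pose Phi := invmx ((a%:C)%C *: invmx K + V).
have pdPhi : herm_pd Phi by apply: herm_pdV.
have EPhi : (K *m V + (a%:C)%C%:M) *m Phi = K.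
  by rewrite factor -mulmxA mulmxV ?mulmx1 ?herm_pd_unitmx.
pose P := info C A Phi; have pdP : herm_pd P by apply/info_pd/herm_pd_psd.
have dP := det_pd_gt0 n0 pdP; have dC := det_pd_gt0 n0 pdC.
have [t [Q E0]] := trace_info_bound a (invmx P) C A V Phi.
(* The tangent of [- ln det] at [P] is [n - ln det P - tr (P^-1 J)]. Evaluated at the majorant, it
   splits into a constant and the linear part [- Q]. *)
exists (n%:R - ln (complex.Re (\det P)) - complex.Re t), (- Q).
have trN G : complex.Re (\tr (- Q *m G)) = complex.Re t
    - complex.Re (\tr (invmx P *m info C A (gain_bound a V Phi G))).
  by rewrite E0 mulNmx raddfN ReN ReD opprD addNKr.
split=> [m H|].
  have psdG := gram_psd H.
  have uV := herm_pd_unitmx (noise_pd H a0 psdV).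
  have uW := herm_pd_unitmx (noise_pd H a0 psdW).
  have psdX := gain_psd H a0 psdV.
  have pdJ := info_pd A pdC psdX.
  have UYJ := congr1 determinant (woodbury_gain uC EW uV uW).
  rewrite det_mulmx det1 in UYJ.
  rewrite [leRHS](ln_Re_inv (det_pd_gt0 n0 pdJ) UYJ) trN.
  have psdD := gain_bound_psd a0 psdV psdG psdX.1 pdPhi.1 (gain_eqn uV).
  exact: (arith1 _ _ _ _ _ _ (ln_det_le n0 pdP pdJ)
                             (trace_info_le A n0 pdP pdC.1 psdD)).
(* The majorant touches the gain at [G = K]: the difference has the factor [Phi - Phi]. *)
have boundK : gain_bound a V Phi K = Phi.
  apply/eqP; rewrite -subr_eq0.
  by rewrite (gain_boundB Phi a0 psdV.1 pdK.1 pdPhi.1 EPhi) subrr mulmx0.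
have trP : \tr (invmx P *m P) = n%:R.
  by rewrite mulVmx ?mxtrace1 // herm_pd_unitmx.
rewrite trN boundK -/P trP Re_natr.
have dE : \det P * \det C * \det (K *m V + (a%:C)%C%:M)
    = \det (K *m W + (a%:C)%C%:M) := det_information uC EW EPhi.
rewrite -dE (ln_Re_mul (mulr_gt0 dP dC) (det_gt0 _ psdV)) (ln_Re_mul dP dC).
exact: arith2.
Qed.

End LogDetBounds.

(** * Monotonicity and linearity of expectations *)

Section Expectation.
Local Set Implicit Arguments.
Local Unset Strict Implicit.
Context (d : measure_display) (T : measurableType d) (R : realType).
Implicit Types f g : T -> R.

(* No measurability is needed: the integral of a nonnegative function is a
   supremum over the simple functions below it. *)
Lemma le_integralT (mu : {measure set T -> \bar R}) (f g : T -> \bar R) :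
  (forall x, f x <= g x)%E ->
  (\int[mu]_(x in setT) f x <= \int[mu]_(x in setT) g x)%E.
Proof.
move=> fg; rewrite integralE [leRHS]integralE.
have nnle (u v : T -> \bar R) : (forall x, 0 <= u x)%E -> (forall x, u x <= v x)%E ->
    (\int[mu]_(x in setT) u x <= \int[mu]_(x in setT) v x)%E.
  move=> u0 uv; have v0 x : (0 <= v x)%E := le_trans (u0 x) (uv x).
  rewrite !ge0_integralTE //; apply: le_ereal_sup => _ [h hu <-].
  by exists h => // x; apply: le_trans (hu x) (uv x).
apply: leeB; apply: nnle => x; rewrite ?funepos_ge0 ?funeneg_ge0 //.
- by rewrite !funeposE ge_max !le_max lexx fg orbT.
- by rewrite !funenegE ge_max !le_max lexx leeN2 fg orbT.
Qed.

Variable P : probability T R.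

Definition has_mean f (m : R) :=
  P.-integrable setT (EFin \o f) /\ (\int[P]_(x in setT) (f x)%:E)%E = m%:E.

Lemma has_mean_Rintegral f :
  P.-integrable setT (fun x => (f x)%:E) -> has_mean f (Rintegral P setT f).
Proof. by move=> If; split=> //; rewrite fineK //; apply: integrable_fin_num. Qed.

Lemma has_mean_cst m : has_mean (fun=> m) m.
Proof.
split; first exact: finite_measure_integrable_cst.
rewrite integral_cst // -[RHS]mule1; congr (_ * _)%E; exact: probability_setT.
Qed.

Lemma has_meanD f g m1 m2 :
  has_mean f m1 -> has_mean g m2 -> has_mean (fun x => f x + g x) (m1 + m2).
Proof.
move=> [If Ef] [Ig Eg]; split; first exact: (integrableD _ If Ig).
by rewrite EFinD -Ef -Eg -(integralD _ If Ig).
Qed.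

Lemma has_meanZ (a : R) f m : has_mean f m -> has_mean (fun x => a * f x) (a * m).
Proof.
move=> [If Ef]; split; first exact: (integrableZl _ a If).
by rewrite EFinM -Ef -(integralZl _ If).
Qed.

Lemma has_mean_sum I (s : seq I) (f : I -> T -> R) (m : I -> R) :
  (forall i, has_mean (f i) (m i)) ->
  has_mean (fun x => \sum_(i <- s) f i x) (\sum_(i <- s) m i).
Proof.
move=> fm; elim: s => [|i s IHs].
  by under eq_fun do rewrite big_nil; rewrite big_nil; apply: has_mean_cst.
by under eq_fun do rewrite big_cons; rewrite big_cons; apply: has_meanD.
Qed.

(** Real and imaginary parts of the entries are the functions through which [mexpect] is defined. *)
Lemma Re_trace_mul n (Q G : 'M[R[i]]_n) : complex.Re (\tr (Q *m G)) =
  \sum_(i < n) \sum_(j < n) (complex.Re (Q i j) * complex.Re (G j i)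
    + - complex.Im (Q i j) * complex.Im (G j i)).
Proof.
have ReS I (s : seq I) (F : I -> R[i]) :
    complex.Re (\sum_(i <- s) F i) = \sum_(i <- s) complex.Re (F i).
  by elim: s => [|i s IHs]; rewrite ?big_nil // !big_cons ReD IHs.
rewrite /mxtrace ReS; apply: eq_bigr => i _; rewrite mxE ReS.
by apply: eq_bigr => j _; case: (Q i j) (G j i) => [a b] [c e] /=; rewrite mulNr.
Qed.

Lemma has_mean_trace n (Q : 'M[R[i]]_n) (G : T -> 'M[R[i]]_n) :
  (forall i j, P.-integrable setT (fun x => (complex.Re (G x i j))%:E)) ->
  (forall i j, P.-integrable setT (fun x => (complex.Im (G x i j))%:E)) ->
  has_mean (fun x => complex.Re (\tr (Q *m G x)))
           (complex.Re (\tr (Q *m mexpect P G))).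
Proof.
move=> IRe IIm; rewrite Re_trace_mul; under eq_fun do rewrite Re_trace_mul.
apply: has_mean_sum => i; apply: has_mean_sum => j; rewrite mxE /=.
by apply: has_meanD; apply: has_meanZ; apply: has_mean_Rintegral.
Qed.

End Expectation.

(** * Semidefiniteness of the covariance sums and of the Schur complement [D] *)

Section Covariances.
Local Set Implicit Arguments.
Local Unset Strict Implicit.
Variables (R : rcfType) (n L : nat) (Sigma : nat -> 'M[R[i]]_n) (l : nat).
Variable F : 'M[R[i]]_n.
Hypothesis pdSigma : forall t, (1 <= t <= L)%N -> herm_pd (Sigma t).
Hypothesis lL : (1 <= l <= L)%N.

Lemma SigmaS_psd : herm_psd (SigmaS Sigma l).
Proof.
rewrite /SigmaS big_nat; apply: herm_psd_sum => t /andP[t1 tl].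
apply/herm_pd_psd/pdSigma; rewrite t1 (leq_trans (ltnW tl)) //.
by case/andP: lL.
Qed.

Lemma SigmaRest_psd : herm_psd (SigmaRest L Sigma l).
Proof.
rewrite /SigmaRest big_nat; apply: herm_psd_sum => t /andP[lt tL].
by apply/herm_pd_psd/pdSigma; rewrite (leq_ltn_trans _ lt).
Qed.

Lemma Cmat_pd : herm_pd (Cmat Sigma F l).
Proof.
rewrite /Cmat addrC; apply: (herm_pdD (pdSigma lL)).
by have := herm_psd_congr (hermT F) SigmaS_psd; rewrite hermTK.
Qed.

Lemma Dmat_psd : herm_psd (Dmat Sigma F l).
Proof.
have pdC := Cmat_pd; have psdS := SigmaS_psd; have pdl := pdSigma lL.
have hA : hermT (Amat Sigma F l) = SigmaS Sigma l *m hermT F + Sigma l.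
  by rewrite /Amat hermTD hermTM psdS.1 pdl.1.
(* With [T = C^-1 A] the square can be completed: [D] becomes a sum of two congruences, of [SigmaS]
   and of [Sigma l]. *)
have CT := mulKVmx (herm_pd_unitmx pdC) (Amat Sigma F l).
have TC := congr1 (@hermT _ _ _) CT; rewrite hermTM pdC.1 hA in TC.
have := schur_complementE (erefl _) CT TC; rewrite -hA mulmxA => E.
rewrite /Dmat [X in herm_psd X]E.
move: (invmx _ *m _) => T.
have -> : 1%:M - hermT T *m F = hermT (1%:M - hermT F *m T).
  by rewrite hermTB hermT1 hermTM hermTK.
have -> : 1%:M - hermT T = hermT (1%:M - T) by rewrite hermTB hermT1.
apply: (herm_psdD (herm_psd_congr _ psdS)).
exact: (herm_psd_congr _ (herm_pd_psd pdl)).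
Qed.

Lemma SigmaUY_gain m (a : R) (H : 'M[R[i]]_(m, n)) : SigmaUY L Sigma F a l H =
  Cmat Sigma F l - Amat Sigma F l
    *m gain (a%:C)%C (Bmat Sigma l + SigmaRest L Sigma l) H (hermT H)
    *m hermT (Amat Sigma F l).
Proof.
by rewrite mul_gainD.
Qed.

End Covariances.

(** * Jensen's inequality for the rate *)

Theorem theorem2 (R : realType) (d : measure_display) (Omega : measurableType d)
  (P : probability Omega R) (Nt Nr L : nat) (N0 : R)
  (Sigma : nat -> 'M[R[i]]_Nt) (l : nat) (F : 'M[R[i]]_Nt)
  (H : Omega -> 'M[R[i]]_(Nr, Nt)) :
  (0 < Nt)%N -> (0 < Nr)%N -> (0 < L)%N -> 0 < N0 ->
  (forall t, (1 <= t <= L)%N -> herm_pd (Sigma t)) ->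
  (1 <= l <= L)%N ->
  (forall i j, measurable_fun setT (fun w => complex.Re (H w i j))) ->
  (forall i j, measurable_fun setT (fun w => complex.Im (H w i j))) ->
  (forall i j, P.-integrable setT (fun w => (complex.Re ((hermT (H w) *m H w) i j))%:E)) ->
  (forall i j, P.-integrable setT (fun w => (complex.Im ((hermT (H w) *m H w) i j))%:E)) ->
  herm_pd (mexpect P (fun w => hermT (H w) *m H w)) ->
  (rate P L Sigma F N0 l H <=
     (rate_upp L Sigma F N0 l (mexpect P (fun w => hermT (H w) *m H w)))%:E)%E.
Proof.
move=> Nt0 _ _ N00 pdSigma lL _ _ IRe IIm pdK.
have pdC := Cmat_pd F pdSigma lL.
have psdV := herm_psdD (Dmat_psd F pdSigma lL) (SigmaRest_psd l pdSigma).
have EW : Bmat Sigma l + SigmaRest L Sigma l =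
    (Dmat Sigma F l + SigmaRest L Sigma l) + hermT (Amat Sigma F l)
    *m invmx (Cmat Sigma F l) *m Amat Sigma F l.
  by rewrite [RHS]addrAC /Dmat subrK.
(* [k] and [Q] do not depend on the sample point, so the minorant integrates to its value at
   [E G]. *)
have [k [Q [kQ_le kQ_eq]]] := ln_det_tangent Nt0 N00 pdC psdV pdK EW.
have [_ EkQ] := has_meanZ (ln 2)^-1
  (has_meanD (has_mean_cst P k) (has_mean_trace Q IRe IIm)).
have ln2 : 0 < ln 2 :> R by rewrite ln_gt0 // ltr1n.
have arith (x c v w : R) :
  x - c / ln 2 - (v / ln 2 - w / ln 2) = x - (ln 2)^-1 * (c + (v - w)) by ring.
(* Both sides become [log2det (Sigma l)] minus an integral, the right one being that of the minorant
   divided by [ln 2]. *)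
rewrite /rate /rate_upp {2 3 4}/log2det arith -kQ_eq EFinB -EkQ.
apply: leeB => //; apply: le_integralT => w.
by rewrite lee_fin SigmaUY_gain /log2det mulrC ler_pM2r ?invr_gt0.
Qed.
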